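(* Let $K$ be a field with $\operatorname{char}K\neq 2$, and let $\mathbf Q$ be the Lie subsuperalgebra of $(\operatorname{End}\Lambda)^{(-)}$ generated by the pivot elements $v_0,v_1,v_2$ (notation in context). Then a basis of $\mathbf Q$ is given by the following standard monomials: (i) (first type) all $r_{n-3}v_n$, $n\ge 0$, where $r_{n-3}$ runs over all tail monomials, except the monomials $x_0x_1^{\xi_1}v_4$ (i.e. length $4$ monomials containing $x_0$) and $x_0x_1^{\xi_1}x_2^{\xi_2}x_3x_4^{\xi_4}v_7$ (i.e. length $7$ monomials containing both $x_0$ and $x_3$), $\xi_j\in\{0,1\}$; (ii) (second type) $x_1v_3,\ x_2v_4,\ x_3v_5$, together with all $r_{n-5}x_{n-2}v_n$, $n\ge 6$, where $r_{n-5}$ runs over all tail monomials, except the monomials $x_0x_1^{\xi_1}x_2^{\xi_2}x_5v_7$ and $x_0x_1^{\xi_1}x_2^{\xi_2}x_3x_4^{\xi_4}x_5x_8v_{10}$, $\xi_j\in\{0,1\}$.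
   Context: $\Lambda$ is the Grassmann algebra over $K$ on odd generators $x_0,x_1,\dots$; $x_i$ is identified with left multiplication by $x_i$ on $\Lambda$; $\partial_i$ is the odd superderivation with $\partial_i(x_j)=\delta_{ij}$. The pivot elements are $v_i=\sum_{k\ge0}\big(\prod_{n=0}^{k-1}x_{i+3n}x_{i+3n+1}\big)\partial_{i+3k}$ ($i\ge0$), well-defined odd superderivations of $\Lambda$. $(\operatorname{End}\Lambda)^{(-)}$ is the Lie superalgebra with supercommutator $[a,b]=ab-(-1)^{|a||b|}ba$. A tail monomial is $r_m=x_0^{\xi_0}x_1^{\xi_1}\cdots x_m^{\xi_m}$ with $\xi_i\in\{0,1\}$ (for $m<0$, $r_m=1$); the monomials above are compositions of operators in $\operatorname{End}\Lambda$. *)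

(* Defs.v *)
From HB Require Import structures.
From mathcomp Require Import all_boot all_order all_algebra.
From mathcomp Require Import finmap.
From mathcomp.multinomials Require Import monalg.


Unset Strict Implicit.
Unset Printing Implicit Defensive.

Import GRing.Theory.
Local Open Scope fset_scope.
Local Open Scope ring_scope.

(* Grassmann algebra over K on odd generators x_0, x_1, ... :
   the free K-module on finite subsets S of nat; the basis element for
   S = {s1 < ... < sk} is the monomial x_{s1} x_{s2} ... x_{sk}. *)
Definition Lam (K : fieldType) := {malg K[{fset nat}]}.

Definition xmon (K : fieldType) (S : {fset nat}) : Lam K := << S >>.

(* number of elements of S smaller than i: the sign exponent when moving
   x_i past the generators of x_S with smaller index *)
Definition nbelow (i : nat) (S : {fset nat}) : nat :=
  count (fun j => j < i)%N (enum_fset S).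

Definition lin_ext (K : fieldType) (f : {fset nat} -> Lam K) : Lam K -> Lam K :=
  fun p => \sum_(S <- msupp p) p@_S *: f S.

Definition xop (K : fieldType) (i : nat) : Lam K -> Lam K :=
  lin_ext K (fun S => if i \in S then 0
                    else (-1) ^+ (nbelow i S) *: xmon K (i |` S)).

(* the odd superderivation d_i with d_i(x_j) = delta_ij *)
Definition dop (K : fieldType) (i : nat) : Lam K -> Lam K :=
  lin_ext K (fun S => if i \in S then (-1) ^+ (nbelow i S) *: xmon K (S `\ i)
                    else 0).

Definition prodx (K : fieldType) (l : seq nat) : Lam K -> Lam K :=
  foldr (fun j f => xop K j \o f) id l.

Definition pivot_list (i k : nat) : seq nat :=
  flatten [seq [:: (i + 3 * n)%N; (i + 3 * n).+1] | n <- iota 0 k].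

(* pivot element v_i = sum_{k>=0} (prod_{n<k} x_{i+3n} x_{i+3n+1}) d_{i+3k}.
   On a basis monomial x_S only the terms with i+3k in S can be nonzero,
   so truncating the sum at k <= max S is exact. *)
Definition vop (K : fieldType) (i : nat) : Lam K -> Lam K :=
  lin_ext K (fun S => \sum_(k < (\max_(s <- enum_fset S) s).+1)
                     prodx K (pivot_list i k) (dop K (i + 3 * k) (xmon K S))).

(* supercommutator [a,b] = ab - (-1)^{|a||b|} ba of homogeneous operators
   of parities pa, pb (true = odd) *)
Definition sbr (K : fieldType) (pa pb : bool) (a b : Lam K -> Lam K)
  : Lam K -> Lam K :=
  fun p => a (b p) - (-1) ^+ (pa && pb) *: b (a p).

Inductive lword : Type :=
| LGen of 'I_3
| LBr of lword & lword.

Fixpoint lpar (w : lword) : bool :=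
  match w with
  | LGen _ => true
  | LBr a b => lpar a (+) lpar b
  end.

Fixpoint leval (K : fieldType) (w : lword) : Lam K -> Lam K :=
  match w with
  | LGen i => vop K (nat_of_ord i)
  | LBr a b => sbr K (lpar a) (lpar b) (leval K a) (leval K b)
  end.

(* standard monomials: (false, n, S) denotes r_{n-3} v_n (first type) and
   (true, n, S) denotes r_{n-5} x_{n-2} v_n (second type), where the tail
   monomial r is the product of x_s, s in S, in increasing order. *)
Definition std := (bool * nat * {fset nat})%type.

Definition std_op (K : fieldType) (j : std) : Lam K -> Lam K :=
  let: (t, n, T) := j in
  if t then prodx K (sort leq (enum_fset T)) \o xop K (n - 2) \o vop K n
  else prodx K (sort leq (enum_fset T)) \o vop K n.

Definition std_valid (j : std) : bool :=
  let: (t, n, T) := j in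
  if ~~ t then
    [&& all (fun s => s + 3 <= n)%N (enum_fset T),
        ~~ ((n == 4)%N && (0%N \in T)) &
        ~~ [&& n == 7, 0%N \in T & 3%N \in T]]
  else
    ((n \in [:: 3; 4; 5])%N && (T == fset0))
    || [&& (6 <= n)%N, all (fun s => s + 5 <= n)%N (enum_fset T),
           ~~ ((n == 7)%N && (0%N \in T)) &
           ~~ [&& n == 10, 0%N \in T, 3%N \in T & 5%N \in T]].

(* Main.v *)
Require Import Defs.
From HB Require Import structures.
From mathcomp Require Import all_boot all_order all_algebra.
From mathcomp Require Import finmap boolp zify.
From mathcomp.multinomials Require Import monalg.

Unset Strict Implicit.
Unset Printing Implicit Defensive.
Set Implicit Arguments.

Import GRing.Theory.
Local Open Scope fset_scope.
Local Open Scope ring_scope.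

(** The multiplications [x_i], the derivations [d_i] and the pivots satisfy
    the Clifford relations, [v_i = d_i + x_i x_(i+1) v_(i+3)], and [v_n]
    anticommutes with [x_j] and [d_j] for [j < n]. In any algebra with such
    elements, writing [{a, b} = ab + ba],
      [{v_i, v_i} = 2 x_(i+1) v_(i+3)],  [{v_i, v_(i+1)} = - x_i v_(i+3)],
      [{v_i, v_(i+2)} = - x_i x_(i+1) x_(i+2) v_(i+5)],
      [{v_i, v_m} = x_i x_(i+1) {v_(i+3), v_m}] for [m >= i + 2].

    Spanning: the span of the standard monomials is stable under brackets with
    [v_0], [v_1], [v_2], hence, by the Jacobi identity, with every iterated
    bracket.

    Membership: [[v_i, x_i x_S v_m] = x_S v_m] when [i < m] is not in [S], so
    only the maximal standard monomials on each [v_m] are needed; these come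
    from brackets [[x_S v_n, x_T v_m] = +- x_S x_T {v_n, v_m}] with
    [m - n <= 2].

    Independence: [v_n] maps [x_n] to [1] and [v_m] kills [x_n] for [m > n], so
    evaluating a linear relation at [x_0], [x_1], ... kills its coefficients
    one pivot at a time. *)

Lemma mem_take_drop (T : eqType) (x0 : T) (l : seq T) k s :
    uniq l -> (k < size l)%N ->
  (s \in take k l ++ drop k.+1 l) = (s \in l) && (s != nth x0 l k).
Proof.
move=> uniq_l lt_k; rewrite -{1 2}(index_uniq x0 lt_k uniq_l) -remE.
by rewrite mem_rem_uniq // inE andbC.
Qed.

(** * Spans and superbrackets *)

Section Span.
Variables (R : pzRingType) (V : lmodType R).
Variables (I : Type) (F : I -> V) (P : pred I).

Definition linspan : {pred V} := fun a => `[< exists s : seq (R * I),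
  all (fun w => P w.2) s /\ a = \sum_(w <- s) w.1 *: F w.2 >].

Lemma linspanP a : reflect (exists s : seq (R * I),
  all (fun w => P w.2) s /\ a = \sum_(w <- s) w.1 *: F w.2) (a \in linspan).
Proof. exact: asboolP. Qed.

Fact linspan_subsemimod_closed : GRing.subsemimod_closed linspan.
Proof.
split=> [|k _ /linspanP[s [Ps ->]]].
  split=> [|_ _ /linspanP[s [Ps ->]] /linspanP[t [Pt ->]]]; apply/linspanP.
    by exists [::]; rewrite big_nil.
  by exists (s ++ t); rewrite all_cat Ps Pt big_cat.
apply/linspanP; exists [seq (k * w.1, w.2) | w <- s].
rewrite all_map Ps scaler_sumr big_map; split=> //.
by apply: eq_bigr => w _; rewrite scalerA.
Qed.

HB.instance Definition _ :=
  GRing.isSubmodClosed.Build R V linspan linspan_subsemimod_closed.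

Lemma mem_linspan i : P i -> F i \in linspan.
Proof.
move=> Pi; apply/linspanP; exists [:: (1, i)].
by rewrite /= Pi big_seq1 scale1r.
Qed.

Lemma linear_linspan (W : lmodType R) (f : {linear V -> W})
    (S : submodClosed W) :
  (forall i, P i -> f (F i) \in S) -> {in linspan, forall a, f a \in S}.
Proof.
move=> fF _ /linspanP[s [+ ->]]; elim: s => [|w s IH] /=.
  by rewrite big_nil linear0 rpred0.
move=> /andP[Pw /IH Ss]; rewrite big_cons linearD linearZ rpredD //.
by rewrite rpredZ ?fF.
Qed.

End Span.

Section Superbracket.
Variables (R : comPzRingType) (A : algType R).
Implicit Types (p q : bool) (a b c : A).

Definition anticomm a b := a * b + b * a.

Lemma anticommC a b : anticomm a b = anticomm b a.
Proof. exact: addrC. Qed.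

Lemma anticomm0 a b : anticomm a b = 0 -> a * b = - (b * a).
Proof. by move/eqP; rewrite addr_eq0 => /eqP. Qed.

Definition superbr p q a b := a * b - (-1) ^+ (p && q) *: (b * a).

Fact superbr_is_linear p q a : linear (superbr p q a).
Proof.
move=> k b c; rewrite /superbr mulrDr mulrDl -scalerAr -scalerAl scalerBr.
by rewrite !scalerDr opprD addrACA !scalerA [_ * k]mulrC.
Qed.

HB.instance Definition _ p q a :=
  GRing.isLinear.Build R A A *:%R (superbr p q a) (@superbr_is_linear p q a).

Lemma superbrC p q a b :
  superbr p q a b = (- (-1) ^+ (p && q)) *: superbr q p b a.
Proof.
rewrite /superbr scaleNr scalerBr scalerA andbC -signr_addb addbb scale1r.
by rewrite opprB.
Qed.

Lemma superbr_jacobi p q r a b c :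
  superbr (p (+) q) r (superbr p q a b) c =
  superbr p (q (+) r) a (superbr q r b c)
  - (-1) ^+ (p && q) *: superbr q (p (+) r) b (superbr p r a c).
Proof.
pose s (b : bool) : R := (-1) ^+ b; rewrite /superbr -!/(s _).
have ss (b1 b2 : bool) : s b1 * s b2 = s (b1 (+) b2) by rewrite /s signr_addb.
rewrite !(mulrBl, mulrBr) -!(scalerAl, scalerAr) !scalerBr !scalerA -!mulrA !ss.
have [-> -> -> ->] : [/\ (p && q) (+) (q && (p (+) r)) = q && r,
    (p && q) (+) (p && r) = p && (q (+) r),
    p && (q (+) r) (+) q && r = (p (+) q) && r (+) p && q &
    (p && q) (+) (q && (p (+) r) (+) p && r) = (p (+) q) && r].
  by case: p; case: q; case: r.
rewrite !opprB !addrA [RHS](ACl (1 * 8 * 3 * 6 * (2 * 5) * (4 * 7))) /=.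
by rewrite !addNr !addr0.
Qed.

Lemma superbr_linspan (I J : Type) (F : I -> A) (P : pred I) (G : J -> A)
    (Q : pred J) (S : submodClosed A) p q :
    (forall i j, P i -> Q j -> superbr p q (F i) (G j) \in S) ->
  {in linspan F P & linspan G Q, forall a b, superbr p q a b \in S}.
Proof.
move=> FG a b aF bG; rewrite superbrC; apply: rpredZ.
apply: (linear_linspan _ aF) => i Pi /=; rewrite superbrC; apply: rpredZ.
by apply: (linear_linspan _ bG) => j Qj; apply: FG.
Qed.

Lemma superbr_odd_mul q a y b :
  superbr true (~~ q) a (y * b) = anticomm a y * b - y * superbr true q a b.
Proof.
rewrite /superbr /anticomm mulrDl mulrBr -!mulrA -scalerAr opprB addrACA subrr.
by rewrite addr0 !scaler_sign; case: q; rewrite ?opprK.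
Qed.

Lemma anticomm_superbr a b : superbr true true a b = anticomm a b.
Proof. by rewrite /superbr scaleN1r opprK. Qed.

Lemma superbr_prod q a (I : Type) (i0 : I) (y : I -> A) (l : seq I) b :
  superbr true (odd (size l) (+) q) a ((\prod_(i <- l) y i) * b) =
  \sum_(k < size l) (-1) ^+ k *:
    ((\prod_(i <- take k l) y i) * anticomm a (y (nth i0 l k)) *
     ((\prod_(i <- drop k.+1 l) y i) * b)) +
  (-1) ^+ size l *: ((\prod_(i <- l) y i) * superbr true q a b).
Proof.
elim: l => [|i l IH] /=; first by rewrite big_ord0 big_nil !mul1r scale1r add0r.
rewrite big_cons -mulrA addNb superbr_odd_mul IH big_ord_recl /= big_nil drop0.
rewrite mul1r scale1r -addrA mulrDr opprD mulr_sumr -sumrN exprS.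
congr (_ + (_ + _)); last by rewrite -scalerAr mulrA mulN1r scaleNr.
apply: eq_bigr => k _.
by rewrite /bump add1n /= big_cons exprS mulN1r scaleNr -scalerAr !mulrA.
Qed.

Lemma anticomm_prod a (I : eqType) (y : I -> A) (l : seq I) :
    {in l, forall i, anticomm a (y i) = 0} ->
  a * (\prod_(i <- l) y i) = (-1) ^+ size l *: ((\prod_(i <- l) y i) * a).
Proof.
elim: l => [|i l IH] /= ay; first by rewrite big_nil mulr1 mul1r scale1r.
rewrite big_cons mulrA (anticomm0 (ay i (mem_head _ _))) mulNr -!mulrA IH.
  by rewrite exprS mulN1r scaleNr -scalerAr.
by move=> j jl; apply: ay; rewrite inE jl orbT.
Qed.

Section OddProducts.
Variables (I : eqType) (y : I -> A).
Hypothesis y_anticomm : forall i j, anticomm (y i) (y j) = 0.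

Lemma prod_odd_comm (l1 l2 : seq I) :
  (\prod_(i <- l1) y i) * (\prod_(i <- l2) y i) =
  (-1) ^+ (size l1 * size l2) *:
    ((\prod_(i <- l2) y i) * (\prod_(i <- l1) y i)).
Proof.
elim: l1 => [|i l IH] /=; first by rewrite big_nil mulr1 mul1r scale1r.
rewrite big_cons -mulrA IH -scalerAr [y i * (_ * _)]mulrA.
rewrite (@anticomm_prod (y i)) // -scalerAl.
by rewrite -mulrA scalerA -exprD addnC mulSn.
Qed.

Lemma prod_odd_perm (l1 l2 : seq I) : perm_eq l1 l2 ->
  exists k : nat, \prod_(i <- l2) y i = (-1) ^+ k *: \prod_(i <- l1) y i.
Proof.
move=> e12; apply: (@catCA_perm_ind _ (fun l => exists k : nat,
  \prod_(i <- l) y i = (-1) ^+ k *: \prod_(i <- l1) y i) _ l1 l2 e12).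
  move=> s1 s2 s3 [k e]; exists (size s2 * size s1 + k)%N.
  by rewrite exprD -scalerA -e !big_cat /= !mulrA prod_odd_comm -scalerAl.
by exists 0%N; rewrite scale1r.
Qed.

Lemma prod_odd_nuniq (l : seq I) : (forall i, y i * y i = 0) ->
  ~~ uniq l -> \prod_(i <- l) y i = 0.
Proof.
move=> y_sq; elim: l => [//|i l IH] /=; rewrite negb_and negbK big_cons.
case/orP => [il | /IH ->]; last by rewrite mulr0.
have [k ->] := prod_odd_perm (etrans (perm_sym _ _) (perm_to_rem il)).
by rewrite big_cons -scalerAr mulrA y_sq mul0r scaler0.
Qed.

End OddProducts.
End Superbracket.

(** * The algebra of linear endomorphisms *)

(* The unused hypothesis is what makes [1 != 0] provable. *)
Definition linEnd (R : comPzRingType) (V : lmodType R)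
  of (exists u : V, u != 0) : Type := {linear V -> V}.

Section LinearEndomorphisms.
Variables (R : comPzRingType) (V : lmodType R) (V_neq0 : exists u : V, u != 0).
Local Notation E := (linEnd V_neq0).

HB.instance Definition _ := gen_eqMixin E.
HB.instance Definition _ := gen_choiceMixin E.

Definition linEnd_fun (f : E) : {linear V -> V} := f.
Local Coercion linEnd_fun : linEnd >-> GRing.Linear.type.
Implicit Types (f g h : E) (k l : R).

Lemma linEndP f g : f =1 g -> f = g.
Proof.
case: f g => [f [[fD] [fZ]]] [g [[gD] [gZ]]] /= /funext e.
move: fD fZ; rewrite [f]e => fD fZ.
by rewrite (Prop_irrelevance fD gD) (Prop_irrelevance fZ gZ).
Qed.

Definition linEnd_zero : E := (\0 : {linear V -> V}).
Definition linEnd_one : E := (idfun : {linear V -> V}).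
Definition linEnd_opp f : E := (\- f : {linear V -> V}).
Definition linEnd_add f g : E := (f \+ g : {linear V -> V}).
Definition linEnd_mul f g : E := (f \o g : {linear V -> V}).
Definition linEnd_scale k f : E := ( *:%R k \o f : {linear V -> V}).

Fact linEnd_addA : associative linEnd_add.
Proof. by move=> f g h; apply: linEndP => p /=; rewrite addrA. Qed.
Fact linEnd_addC : commutative linEnd_add.
Proof. by move=> f g; apply: linEndP => p /=; rewrite addrC. Qed.
Fact linEnd_add0r : left_id linEnd_zero linEnd_add.
Proof. by move=> f; apply: linEndP => p /=; rewrite add0r. Qed.
Fact linEnd_addNr : left_inverse linEnd_zero linEnd_opp linEnd_add.
Proof. by move=> f; apply: linEndP => p /=; rewrite addNr. Qed.

HB.instance Definition _ :=
  GRing.isZmodule.Build E linEnd_addA linEnd_addC linEnd_add0r linEnd_addNr.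

Fact linEnd_mulA : associative linEnd_mul.
Proof. by move=> f g h; apply: linEndP. Qed.
Fact linEnd_mul1r : left_id linEnd_one linEnd_mul.
Proof. by move=> f; apply: linEndP. Qed.
Fact linEnd_mulr1 : right_id linEnd_one linEnd_mul.
Proof. by move=> f; apply: linEndP. Qed.
Fact linEnd_mulDl : left_distributive linEnd_mul linEnd_add.
Proof. by move=> f g h; apply: linEndP. Qed.
Fact linEnd_mulDr : right_distributive linEnd_mul linEnd_add.
Proof. by move=> f g h; apply: linEndP => p /=; rewrite linearD. Qed.
Fact linEnd_one_neq0 : linEnd_one != linEnd_zero.
Proof.
have [u /eqP u0] := V_neq0.
by apply/eqP => /(congr1 (fun f => linEnd_fun f u)) /u0.
Qed.

HB.instance Definition _ := GRing.Zmodule_isNzRing.Build E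
  linEnd_mulA linEnd_mul1r linEnd_mulr1 linEnd_mulDl linEnd_mulDr
  linEnd_one_neq0.

Fact linEnd_scaleA k l f :
  linEnd_scale k (linEnd_scale l f) = linEnd_scale (k * l) f.
Proof. by apply: linEndP => p /=; rewrite scalerA. Qed.
Fact linEnd_scale1r : left_id 1 linEnd_scale.
Proof. by move=> f; apply: linEndP => p /=; rewrite scale1r. Qed.
Fact linEnd_scaleDr : right_distributive linEnd_scale +%R.
Proof. by move=> k f g; apply: linEndP => p /=; rewrite scalerDr. Qed.
Fact linEnd_scaleDl f : {morph linEnd_scale^~ f : k l / k + l}.
Proof. by move=> k l; apply: linEndP => p /=; rewrite scalerDl. Qed.

HB.instance Definition _ := GRing.Zmodule_isLmodule.Build R E
  linEnd_scaleA linEnd_scale1r linEnd_scaleDr linEnd_scaleDl.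

Fact linEnd_scaleAl k f g : k *: (f * g) = k *: f * g.
Proof. exact: linEndP. Qed.
Fact linEnd_scaleAr k f g : k *: (f * g) = f * (k *: g).
Proof. by apply: linEndP => p /=; rewrite linearZ. Qed.

HB.instance Definition _ := GRing.Lmodule_isLalgebra.Build R E linEnd_scaleAl.
HB.instance Definition _ := GRing.Lalgebra_isAlgebra.Build R E linEnd_scaleAr.

Lemma linEnd_sumE (I : Type) (r : seq I) (F : I -> E) p :
  linEnd_fun (\sum_(i <- r) F i) p = \sum_(i <- r) F i p.
Proof. by elim/big_rec2: _ => //= i q f _ <-. Qed.

End LinearEndomorphisms.

(** * Pivot algebras *)

Record pivotAlgebra (R : comPzRingType) := PivotAlgebra {
  pivot_carrier :> algType R;
  gen : nat -> pivot_carrier;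
  der : nat -> pivot_carrier;
  pivot : nat -> pivot_carrier;
  gen_sq : forall i, gen i * gen i = 0;
  der_sq : forall i, der i * der i = 0;
  anticomm_gen : forall i j, anticomm (gen i) (gen j) = 0;
  anticomm_der_gen : forall i j, anticomm (der i) (gen j) = (i == j)%:R;
  pivotE : forall i, pivot i = der i + gen i * gen i.+1 * pivot i.+3;
  anticomm_pivot_gen0 : forall i j, (j < i)%N ->
    anticomm (pivot i) (gen j) = 0;
  anticomm_pivot_der0 : forall i j, (j < i)%N ->
    anticomm (pivot i) (der j) = 0 }.

Lemma pivot_listS i k :
  pivot_list i k.+1 = [:: i, i.+1 & pivot_list i.+3 k].
Proof.
rewrite /pivot_list /= muln0 addn0; congr [:: _, _ & flatten _].
rewrite -[1%N]/(1 + 0)%N iotaDl -map_comp; apply: eq_map => n /=.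
by congr [:: _; _]; lia.
Qed.

Lemma mem_pivot_list s i k : (s \in pivot_list i k) =
  [&& i <= s, s + 2 <= i + 3 * k & (s - i) %% 3 != 2]%N.
Proof.
elim: k i => [|k IH] i; first by rewrite in_nil; lia.
by rewrite pivot_listS !inE IH; lia.
Qed.

Lemma odd_size_pivot_list i k : odd (size (pivot_list i k)) = false.
Proof. by elim: k i => [//|k IH] i; rewrite pivot_listS /= IH. Qed.

Section PivotRelations.
Variables (R : comPzRingType) (A : pivotAlgebra R).
Local Notation x := (@gen R A).
Local Notation d := (@der R A).
Local Notation v := (@pivot R A).
Local Notation xs l := (\prod_(i <- l) x i).

Lemma genC i j : x i * x j = - (x j * x i).
Proof. exact/anticomm0/anticomm_gen. Qed.

Lemma pivot_gen n j : (j < n)%N -> v n * x j = - (x j * v n).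
Proof. by move=> lt_jn; apply/anticomm0/anticomm_pivot_gen0. Qed.

Lemma der_pivot n j : (j < n)%N -> d j * v n = - (v n * d j).
Proof.
by move=> lt_jn; apply/anticomm0; rewrite anticommC anticomm_pivot_der0.
Qed.

Lemma anticomm_pivot_genS i j : anticomm (v i) (x j) =
  (i == j)%:R + x i * x i.+1 * anticomm (v i.+3) (x j).
Proof.
have xxC : x i * x i.+1 * x j = x j * (x i * x i.+1).
  rewrite -mulrA [x i.+1 * _]genC mulrN [RHS]mulrA [x j * x i]genC mulNr.
  by rewrite mulrA.
rewrite -(anticomm_der_gen A) /anticomm pivotE mulrDl mulrDr addrACA mulrDr.
by rewrite !mulrA xxC !mulrA.
Qed.

Lemma anticomm_pivot_gen i j : anticomm (v i) (x j) =
  if (i <= j)%N && (3 %| j - i)%N then xs (pivot_list i ((j - i) %/ 3)) else 0.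
Proof.
have [n] := ubnP (j - i); elim: n i => [//|n IH] i lt_ji.
have [lt_jlti | le_ij] := ltnP j i; first exact: anticomm_pivot_gen0.
rewrite anticomm_pivot_genS; have [<- | ne_ij] /= := eqVneq i j.
  by rewrite anticomm_pivot_gen0 ?subnn ?big_nil ?mulr0 ?addr0 //; lia.
rewrite add0r IH; last lia.
have [lt_ji3 | le_i3j] := ltnP j i.+3.
  by rewrite !ifF ?mulr0 //; lia.
rewrite (_ : (3 %| j - i) = (3 %| j - i.+3))%N /=; last lia.
case: ifP => _; last by rewrite mulr0.
rewrite (_ : (j - i) %/ 3 = ((j - i.+3) %/ 3).+1)%N; last lia.
by rewrite pivot_listS !big_cons mulrA.
Qed.

Lemma anticomm_pivot_gen_id i : anticomm (v i) (x i) = 1.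
Proof. by rewrite anticomm_pivot_gen leqnn subnn big_nil. Qed.

Lemma anticomm_pivot_ltE i m : (i < m)%N -> anticomm (v i) (v m) =
  x i * (x i.+1 * v i.+3 * v m - v m * (x i.+1 * v i.+3)).
Proof.
move=> lt_im; rewrite /anticomm pivotE mulrDl mulrDr addrACA der_pivot //.
by rewrite addNr add0r mulrBr !mulrA pivot_gen // !mulNr.
Qed.

Lemma gen_anticomm_pivot i m : (i < m)%N -> x i * anticomm (v i) (v m) = 0.
Proof. by move=> lt_im; rewrite anticomm_pivot_ltE // mulrA gen_sq mul0r. Qed.

Lemma pivot_sq i : v i * v i = x i.+1 * v i.+3.
Proof.
set w := x i.+1 * v i.+3.
have vE : v i = d i + x i * w by rewrite mulrA -pivotE.
have wd : d i * w = w * d i.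
  have := anticomm_der_gen A i i.+1; rewrite ltn_eqF // => /anticomm0 dx.
  by rewrite /w mulrA dx mulNr -!mulrA der_pivot ?mulrN ?opprK //; lia.
have wx : w * x i = x i * w.
  rewrite /w -mulrA pivot_gen; last lia.
  by rewrite mulrN !mulrA [x i * _]genC mulNr.
have dx : d i * x i = 1 - x i * d i.
  have := anticomm_der_gen A i i; rewrite eqxx mulr1n => <-.
  by rewrite /anticomm addrK.
have xwx : x i * w * (x i * w) = 0.
  by rewrite -mulrA [w * _]mulrA wx !mulrA gen_sq !mul0r.
rewrite vE mulrDl !mulrDr der_sq add0r xwx addr0 mulrA dx mulrBl mul1r.
by rewrite -[x i * d i * w]mulrA wd mulrA addrNK.
Qed.

Lemma anticomm_pivotS i : anticomm (v i) (v i.+1) = - (x i * v i.+3).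
Proof.
rewrite anticomm_pivot_ltE // -[RHS]mulrN; congr (_ * _).
have vx : v i.+1 * x i.+1 = 1 - x i.+1 * v i.+1.
  by rewrite -(anticomm_pivot_gen_id i.+1) /anticomm addrK.
rewrite [v i.+1 * _]mulrA vx mulrBl mul1r opprB addrA -!mulrA -mulrDr.
by rewrite -/(anticomm _ _) anticommC gen_anticomm_pivot ?add0r //; lia.
Qed.

Lemma anticomm_pivot_shift i m : (i.+1 < m)%N ->
  anticomm (v i) (v m) = x i * x i.+1 * anticomm (v i.+3) (v m).
Proof.
move=> lt_im; rewrite anticomm_pivot_ltE; last lia.
by rewrite [v m * _]mulrA pivot_gen // mulNr opprK -!mulrA -mulrDr.
Qed.

Lemma anticomm_pivotSS i :
  anticomm (v i) (v i.+2) = - (x i * x i.+1 * x i.+2 * v i.+2.+3).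
Proof.
by rewrite anticomm_pivot_shift // anticommC anticomm_pivotS mulrN mulrA.
Qed.

Lemma anticomm_pivot_list i k m : (i + 3 * k <= m)%N ->
  anticomm (v i) (v m) =
  xs (pivot_list i k) * anticomm (v (i + 3 * k)%N) (v m).
Proof.
elim: k i => [|k IH] i le_m; first by rewrite muln0 addn0 big_nil mul1r.
rewrite anticomm_pivot_shift; last lia.
rewrite IH; last lia.
by rewrite pivot_listS !big_cons !mulrA; congr (_ * anticomm (v _) _); lia.
Qed.

Definition pivot_mon (l : seq nat) (n : nat) : A := xs l * v n.

Lemma pivot_mon_nil n : pivot_mon [::] n = v n.
Proof. by rewrite /pivot_mon big_nil mul1r. Qed.

Lemma pivot_mon_cons i l n : pivot_mon (i :: l) n = x i * pivot_mon l n.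
Proof. by rewrite /pivot_mon big_cons mulrA. Qed.

Lemma pivot_mon_cat l1 l2 n : pivot_mon (l1 ++ l2) n = xs l1 * pivot_mon l2 n.
Proof. by rewrite /pivot_mon big_cat mulrA. Qed.

Lemma pivot_mon_nuniq l n : ~~ uniq l -> pivot_mon l n = 0.
Proof.
move=> nuniq_l; rewrite /pivot_mon (prod_odd_nuniq _ (@gen_sq _ A) nuniq_l).
  by rewrite mul0r.
exact: anticomm_gen.
Qed.

Lemma pivot_mon_perm l1 l2 n : perm_eq l1 l2 ->
  exists k : nat, pivot_mon l2 n = (-1) ^+ k *: pivot_mon l1 n.
Proof.
case/(prod_odd_perm (@anticomm_gen _ A)) => k e.
by exists k; rewrite /pivot_mon e scalerAl.
Qed.

Lemma pivot_prod_gen l n : all (gtn n) l ->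
  v n * xs l = (-1) ^+ size l *: (xs l * v n).
Proof.
by move=> /allP lt_ln; apply: anticomm_prod => j /lt_ln/anticomm_pivot_gen0.
Qed.

Lemma superbr_pivot_mon l1 n l2 m :
    all (gtn m) l1 -> all (gtn n) l2 ->
  superbr (~~ odd (size l1)) (~~ odd (size l2)) (pivot_mon l1 n)
    (pivot_mon l2 m) =
  (-1) ^+ size l2 *: (xs (l1 ++ l2) * anticomm (v n) (v m)).
Proof.
move=> lt_l1m lt_l2n; rewrite /superbr /pivot_mon.
have -> : xs l1 * v n * (xs l2 * v m) =
    (-1) ^+ size l2 *: (xs (l1 ++ l2) * (v n * v m)).
  rewrite mulrA -[xs l1 * _ * _]mulrA pivot_prod_gen // -scalerAr -!scalerAl.
  by rewrite big_cat /= !mulrA.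
have -> : xs l2 * v m * (xs l1 * v n) =
    (-1) ^+ (size l1 + size l2 * size l1) *: (xs (l1 ++ l2) * (v m * v n)).
  rewrite mulrA -[xs l2 * _ * _]mulrA pivot_prod_gen // -scalerAr -!scalerAl.
  rewrite [xs l2 * _]mulrA (prod_odd_comm (@anticomm_gen _ A)) -!scalerAl.
  by rewrite scalerA -exprD big_cat /= !mulrA.
rewrite scalerA -scaleNr /anticomm mulrDr scalerDr; congr (_ + _ *: _).
rewrite -![(-1) ^+ (size _ + _)]signr_odd -![(-1) ^+ size _]signr_odd oddD oddM.
by case: odd; case: odd => //=; rewrite ?mulN1r ?mul1r ?opprK.
Qed.

Lemma superbr_pivot_mon0 (y : A) l m : anticomm y (v m) = 0 ->
    {in l, forall j, anticomm y (x j) = 0} ->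
  superbr true (~~ odd (size l)) y (pivot_mon l m) = 0.
Proof.
rewrite /pivot_mon => yv; elim: l => [|j l IH] yx /=.
  by rewrite big_nil mul1r anticomm_superbr.
rewrite big_cons -mulrA superbr_odd_mul yx ?mem_head // mul0r sub0r.
by rewrite IH ?mulr0 ?oppr0 // => i il; rewrite yx // inE il orbT.
Qed.

(* Left multiplication by [x_i] reduces [v_i] to [d_i], which supercommutes
   with the monomial. *)
Lemma gen_superbr_pivot i l m : (i < m)%N -> i \notin l ->
  x i * superbr true (~~ odd (size l)) (v i) (pivot_mon l m) = 0.
Proof.
move=> lt_im il; rewrite /superbr; set a := pivot_mon l m.
set s := (-1) ^+ _.
have xa : x i * a = s *: (a * x i).
  apply/subr0_eq/superbr_pivot_mon0 => [|j _]; last exact: anticomm_gen.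
  by rewrite anticommC anticomm_pivot_gen0.
have da : d i * a = s *: (a * d i).
  apply/subr0_eq/superbr_pivot_mon0 => [|j jl].
    by rewrite anticommC anticomm_pivot_der0.
  by rewrite anticomm_der_gen; case: eqP il => // ->; rewrite jl.
have xax w : x i * (a * (x i * w)) = 0.
  rewrite mulrA xa -scalerAl -mulrA [x i * (x i * w)]mulrA gen_sq mul0r mulr0.
  exact: scaler0.
rewrite pivotE mulrBr mulrDl !mulrDr -scalerAr mulrDr da.
rewrite -[x i * x i.+1 * _]mulrA -!(mulrA (x i)) [x i * (x i * _)]mulrA.
by rewrite gen_sq mul0r xax !addr0 -scalerAr subrr.
Qed.

Lemma superbr_pivot_gen i l m : (i < m)%N -> i \notin l ->
  superbr true (odd (size l)) (v i) (pivot_mon (i :: l) m) = pivot_mon l m.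
Proof.
move=> lt_im il; rewrite /pivot_mon big_cons -mulrA -[odd _]negbK.
rewrite superbr_odd_mul anticomm_pivot_gen_id mul1r.
by rewrite gen_superbr_pivot ?subr0.
Qed.

End PivotRelations.

(** * Standard monomials *)

(* Here [l] lists all the generators of the monomial, including [x_(n-2)] in
   the second type. *)
Definition first_type (l : seq nat) (n : nat) : bool :=
  [&& all (fun s => s + 3 <= n)%N l, ~~ ((n == 4%N) && (0%N \in l)) &
      ~~ [&& n == 7%N, 0%N \in l & 3%N \in l]].

Definition second_type (l : seq nat) (n : nat) : bool :=
  [&& (2 < n)%N, (n - 2)%N \in l,
      all (fun s => (s == n - 2)%N || (maxn 6 (s + 5) <= n)%N) l,
      ~~ ((n == 7%N) && (0%N \in l)) &
      ~~ [&& n == 10%N, 0%N \in l, 3%N \in l & 5%N \in l]].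

Definition standard (l : seq nat) (n : nat) : bool :=
  first_type l n || second_type l n.

Lemma standard_nil n : standard [::] n.
Proof. by rewrite /standard /first_type !andbF. Qed.

Lemma standard_le l n s : standard l n -> s \in l -> (s + 2 <= n)%N.
Proof.
move=> /orP[/and3P[/allP le _ _]|/and5P[n2 _ /allP le _ _]] /le; lia.
Qed.

Lemma standard_small l n : (n <= 2)%N -> standard l n -> l = [::].
Proof.
move=> n2 /orP[/and3P[/allP le _ _]|/and5P[]]; last lia.
by case: l le => [//|s l] /(_ s (mem_head _ _)); lia.
Qed.

Definition std_list (j : std) : seq nat :=
  let: (t, n, T) := j in
  sort leq (enum_fset T) ++ (if t then [:: n - 2]%N else [::]).

Lemma mem_std_list (s : nat) t n (T : {fset nat}) :
  (s \in std_list (t, n, T)) = (s \in T) || (t && (s == n - 2)%N).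
Proof. by rewrite mem_cat mem_sort; case: t; rewrite ?inE. Qed.

Lemma std_list_uniq j : std_valid j -> uniq (std_list j).
Proof.
case: j => [[[] n] T] /= val; last by rewrite cats0 sort_uniq fset_uniq.
rewrite cat_uniq sort_uniq fset_uniq /= orbF mem_sort andbT.
case/orP: val => [/andP[_ /eqP ->]|]; first by rewrite inE.
by case/and4P => n6 /allP le _ _; apply/negP => /le /=; lia.
Qed.

Lemma std_list_standard j : std_valid j -> standard (std_list j) j.1.2.
Proof.
case: j => [[[] n] T] val; rewrite [X in standard _ X]/=; apply/orP;
  [right|left]; last first.
  case/and3P: val => /allP le n4 n7; rewrite /first_type !mem_std_list !orbF.
  by apply/and3P; split=> //; apply/allP => s; rewrite mem_std_list orbF => /le.
have [n2 leT] : (2 < n)%N /\ forall s, s \in T -> (maxn 6 (s + 5) <= n)%N.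
  case/orP: val => [/andP[+ /eqP ->]|/and4P[n6 /allP le _ _]].
    by rewrite !inE; split=> [|s]; [lia | rewrite inE].
  by split=> [|s /le /=]; lia.
have [n7 n10] : ~~ ((n == 7%N) && (0%N \in T)) /\
    ~~ [&& n == 10%N, 0%N \in T, 3%N \in T & 5%N \in T].
  by case/orP: val => [/andP[+ _]|/and4P[//]]; rewrite !inE; lia.
apply/and5P; rewrite !mem_std_list eqxx orbT; split=> //; [|lia|lia].
by apply/allP => s; rewrite mem_std_list => /orP[/leT ->|/= ->]; rewrite ?orbT.
Qed.

Lemma std_of_standard l n : uniq l -> standard l n ->
  exists2 j, std_valid j & perm_eq (std_list j) l /\ j.1.2 = n.
Proof.
move=> uniq_l.
have perm j : std_valid j -> std_list j =i l -> perm_eq (std_list j) l.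
  by move=> /std_list_uniq uniq_j; apply: uniq_perm.
case/orP => [/and3P[/allP le n4 n7]|/and5P[n2 nl /allP le n7 n10]].
  have val : std_valid (false, n, [fset s in l]).
    apply/and3P; rewrite !inE; split=> //.
    by apply/allP => s; rewrite in_fset => /le.
  exists (false, n, [fset s in l]) => //; split=> //; apply: perm => // s.
  by rewrite mem_std_list in_fset orbF.
pose T := [fset s in l] `\ (n - 2)%N.
have memT (s : nat) : (s \in T) = (s != n - 2)%N && (s \in l) by rewrite !inE.
have leT s : s \in T -> (maxn 6 (s + 5) <= n)%N.
  by rewrite memT => /andP[ne /le]; rewrite (negPf ne).
have val : std_valid (true, n, T).
  have [n6 | n5] := leqP 6 n; apply/orP; [right | left].
    apply/and4P; rewrite !memT; split; [lia | | lia | lia].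
    by apply/allP => s /leT; lia.
  apply/andP; split; first by rewrite !inE; lia.
  apply/eqP/fsetP => s; rewrite inE; apply/negbTE/negP => /leT; lia.
exists (true, n, T) => //; split=> //; apply: perm => // s.
by rewrite mem_std_list memT; case: eqP => [->|]; rewrite ?nl ?orbF.
Qed.

Lemma std_list_inj j1 j2 : std_valid j1 -> std_valid j2 -> j1.1.2 = j2.1.2 ->
  std_list j1 =i std_list j2 -> j1 = j2.
Proof.
have tagE j : std_valid j -> j.1.1 = (j.1.2 - 2 \in std_list j)%N.
  case: j => [[[] n] T] val; rewrite mem_std_list ?eqxx ?orbT //= orbF.
  by apply/esym/negbTE/negP; case/and3P: val => /allP le _ _ /le /=; lia.
move=> val1 val2 en el; have et : j1.1.1 = j2.1.1 by rewrite !tagE // en el.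
move: (std_list_uniq val1) (std_list_uniq val2) => {tagE val1 val2}.
case: j1 j2 en et el => [[t n] T1] [[t' n'] T2] /= <- <- el u1 u2.
congr (_, _, _); apply/fsetP => s; have := el s; rewrite !mem_cat !mem_sort.
case: t u1 u2 {el}; rewrite ?orbF // mem_seq1 !cats1 !rcons_uniq !mem_sort.
move=> /andP[n1 _] /andP[n2 _].
by case: eqP => [->|_]; rewrite ?orbF // (negPf n1) (negPf n2).
Qed.

Section PivotSubstitution.
Variables (i j n : nat) (l l' : seq nat).
Hypothesis jl : j \in l.
Hypothesis mem_l' : forall s : nat, (s \in l') =
  (s \in l) && (s != j) || [&& i <= s, s + 2 <= j & (s - i) %% 3 != 2]%N.
Hypothesis le_ij : (i <= j)%N.
Hypothesis dvd3 : (3 %| j - i)%N.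

Lemma first_type_subst : first_type l n -> first_type l' n.
Proof.
case/and3P => /allP le n4 n7; have le_j := le _ jl; rewrite /= in le_j.
rewrite /first_type !mem_l'; apply/and3P; split.
- by apply/allP => s; rewrite mem_l' => /orP[/andP[/le]|]; lia.
- by lia.
- by lia.
Qed.

Lemma second_type_subst_top :
  j = (n - 2)%N -> second_type l n -> first_type l' n.
Proof.
move=> ej /and5P[n2 _ /allP le n7 _].
have le_l s : s \in l -> s != j -> (maxn 6 (s + 5) <= n)%N.
  by move=> /le /orP[/eqP ->|] //; rewrite ej eqxx.
rewrite /first_type !mem_l'; apply/and3P; split.
- apply/allP => s; rewrite mem_l' => /orP[/andP[sl sj]|]; last lia.
  by have := le_l _ sl sj; lia.
- case: eqP => //= n4; rewrite negb_or negb_and; apply/andP; split; last lia.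
  by case: (boolP (0%N \in l)) => //= /le_l; lia.
- by lia.
Qed.

Lemma second_type_subst :
  j != (n - 2)%N -> second_type l n -> second_type l' n.
Proof.
move=> nej /and5P[n2 nl /allP le n7 n10].
have le_j : (maxn 6 (j + 5) <= n)%N by have := le _ jl; rewrite (negPf nej).
rewrite /second_type !mem_l'; apply/and5P; split=> //.
- by rewrite nl eq_sym nej.
- apply/allP => s; rewrite mem_l' => /orP[/andP[/le]|] //; lia.
- by lia.
- by lia.
Qed.

Lemma standard_subst : standard l n -> standard l' n.
Proof.
case/orP => [std1 | std2]; apply/orP; first by left; apply: first_type_subst.
have [ej | nej] := eqVneq j (n - 2)%N.
  by left; apply: second_type_subst_top.
by right; apply: second_type_subst.
Qed.

End PivotSubstitution.

(** * Stability of the standard span *)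

Lemma standard_exclusions l n : standard l n ->
  ~~ (((n <= 2)%N || (n == 4%N)) && (0%N \in l)) /\
  ~~ [&& (n == 5%N) || (n == 7%N), 0%N \in l & 3%N \in l].
Proof.
case/orP => [/and3P[/allP le n4 n7]|/and5P[n2 _ /allP le n7 _]].
  have le0 : 0%N \in l -> (3 <= n)%N by move/le.
  have le3 : 3%N \in l -> (6 <= n)%N by move/le.
  by split; lia.
have le0 : 0%N \in l -> n = 2%N \/ (6 <= n)%N by move/le; lia.
by split; lia.
Qed.

Section AnticommutatorMonomials.
Variables (i q : nat) (l : seq nat).
Local Notation n := (i + 3 * q)%N.

Lemma mem_cat_pivot_list (s : nat) r : (s \in l ++ pivot_list i q ++ r) =
  [|| s \in l, [&& i <= s, s + 2 <= n & (s - i) %% 3 != 2]%N | s \in r].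
Proof. by rewrite !mem_cat mem_pivot_list. Qed.

Lemma second_type_pivot_sq : standard l n ->
  second_type (l ++ pivot_list i q ++ [:: n.+1]) n.+3.
Proof.
move=> std_l; have [n4 n7] := standard_exclusions std_l.
have le := standard_le std_l.
have small := standard_small _ std_l.
rewrite /second_type !mem_cat_pivot_list !mem_seq1; apply/and5P.
split; [lia | lia | | lia | lia].
apply/allP => s; rewrite mem_cat_pivot_list mem_seq1.
have [n2 | n3] := leqP n 2; first by rewrite small // in_nil; lia.
by case/or3P => [/le||]; lia.
Qed.

Lemma first_type_anticomm_pivotS : standard l n.+1 ->
  first_type (l ++ pivot_list i q ++ [:: n]) n.+3.
Proof.
move=> std_l; have [n4 n7] := standard_exclusions std_l.
have le := standard_le std_l.
rewrite /first_type !mem_cat_pivot_list !mem_seq1.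
apply/and3P; split; [|lia|lia].
apply/allP => s; rewrite mem_cat_pivot_list mem_seq1.
by case/or3P => [/le||]; lia.
Qed.

Lemma first_type_anticomm_pivotSS : standard l n.+2 ->
  first_type (l ++ pivot_list i q ++ [:: n; n.+1; n.+2]) n.+2.+3.
Proof.
move=> std_l; have [n4 n7] := standard_exclusions std_l.
have le := standard_le std_l.
rewrite /first_type !mem_cat_pivot_list !in_cons !in_nil.
apply/and3P; split; [|lia|lia].
apply/allP => s; rewrite mem_cat_pivot_list !inE.
by case/or3P => [/le||/or3P[]]; lia.
Qed.

End AnticommutatorMonomials.

Section StandardSpan.
Variables (R : comPzRingType) (A : pivotAlgebra R).
Local Notation x := (@gen R A).
Local Notation v := (@pivot R A).
Local Notation xs l := (\prod_(i <- l) x i).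
Local Notation mon := (pivot_mon A).

Definition std_val (j : std) : A := mon (std_list j) j.1.2.
Definition std_par (j : std) : bool := ~~ odd (size (std_list j)).

Definition std_span (p : bool) : {pred A} :=
  linspan std_val (fun j => std_valid j && (std_par j == p)).

HB.instance Definition _ p := GRing.SubmodClosed.on (std_span p).

Lemma mon_std_span l n p :
  standard l n -> p = ~~ odd (size l) -> mon l n \in std_span p.
Proof.
move=> std_l ->; have [uniq_l | nuniq_l] := boolP (uniq l); last first.
  by rewrite pivot_mon_nuniq ?rpred0.
have [j val [jl <-]] := std_of_standard uniq_l std_l.
have [k ->] := pivot_mon_perm A j.1.2 jl.
apply/rpredZ/(mem_linspan std_val).
by rewrite val /std_par (perm_size jl) eqxx.
Qed.

Lemma anticomm_std_span i m l : (i <= m)%N -> standard l m ->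
  xs l * anticomm (v i) (v m) \in std_span (odd (size l)).
Proof.
have odd_size t : odd (size t) -> forall q,
    odd (size l) = ~~ odd (size (l ++ pivot_list i q ++ t)).
  move=> odd_t q; rewrite !size_cat !oddD odd_size_pivot_list odd_t.
  by case: odd.
move=> le_im; have [q em] : exists q,
    let n := (i + 3 * q)%N in m = n \/ m = n.+1 \/ m = n.+2.
  by exists ((m - i) %/ 3)%N; lia.
rewrite (anticomm_pivot_list A (_ : i + 3 * q <= m)%N); last by case: em; lia.
case: em => [-> | [-> | ->]] std_l.
- rewrite /anticomm pivot_sq -!pivot_mon_nil -pivot_mon_cons -mulr2n !mulrnAr.
  rewrite -!pivot_mon_cat rpredMn //.
  apply: mon_std_span; last exact: odd_size.
  by rewrite /standard second_type_pivot_sq ?orbT.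
- rewrite anticomm_pivotS -!pivot_mon_nil -pivot_mon_cons !mulrN rpredN.
  rewrite -!pivot_mon_cat.
  apply: mon_std_span; last exact: odd_size.
  by rewrite /standard first_type_anticomm_pivotS.
- rewrite anticomm_pivotSS -!pivot_mon_nil -!mulrA -!pivot_mon_cons !mulrN.
  rewrite rpredN -!pivot_mon_cat.
  apply: mon_std_span; last exact: odd_size.
  by rewrite /standard first_type_anticomm_pivotSS.
Qed.

Lemma superbr_pivot_std_span i l m :
    (i < 3)%N -> uniq l -> standard l m ->
  superbr true (~~ odd (size l)) (v i) (mon l m) \in std_span (odd (size l)).
Proof.
move=> i3 uniq_l std_l.
have := superbr_prod true (v i) 0%N x l (v m); rewrite addbT => ->.
rewrite rpredD ?rpred_sum // => [k _|]; rewrite rpredZ //; last first.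
  rewrite anticomm_superbr; have [le_im | lt_mi] := leqP i m.
    exact: anticomm_std_span.
  have -> : l = [::] by apply: standard_small std_l; lia.
  by rewrite anticommC anticomm_std_span ?standard_nil 1?ltnW.
rewrite anticomm_pivot_gen; case: ifP => [/andP[le_ij dvd]|_]; last first.
  by rewrite mulr0 mul0r rpred0.
set j := nth 0%N l k; set B := pivot_list _ _.
rewrite mulrA -!big_cat -/(mon _ m) -catA; apply: mon_std_span.
  apply: (standard_subst (mem_nth 0%N (ltn_ord k)) _ le_ij dvd std_l) => s.
  rewrite -mem_take_drop // !mem_cat mem_pivot_list orbAC -orbA.
  by rewrite (_ : i + _ = j)%N //; lia.
rewrite -[in LHS](cat_take_drop k l) [in LHS](drop_nth 0%N) // !size_cat !oddD.
by rewrite odd_size_pivot_list /= addbN.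
Qed.

Lemma superbr_std_span i p : (i < 3)%N ->
  {in std_span p, forall b, superbr true p (v i) b \in std_span (~~ p)}.
Proof.
move=> i3; apply: linear_linspan => j /andP[val /eqP <-].
rewrite /std_par negbK.
by apply: superbr_pivot_std_span (std_list_uniq val) (std_list_standard val).
Qed.

Fixpoint word_val (w : lword) : A :=
  match w with
  | LGen i => v i
  | LBr w1 w2 => superbr (lpar w1) (lpar w2) (word_val w1) (word_val w2)
  end.

Lemma superbr_word_std_span w p : {in std_span p, forall b,
  superbr (lpar w) p (word_val w) b \in std_span (lpar w (+) p)}.
Proof.
elim: w p => [i|w1 IH1 w2 IH2] p b bS /=; first exact: superbr_std_span.
rewrite superbr_jacobi; apply: rpredB; last apply: rpredZ.
  by rewrite -addbA; apply: IH1; apply: IH2.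
by rewrite [lpar w1 (+) lpar w2]addbC -addbA; apply: IH2; apply: IH1.
Qed.

Lemma word_val_std_span w : word_val w \in std_span (lpar w).
Proof.
elim: w => [i|w1 IH1 w2 IH2] /=; last exact: superbr_word_std_span.
rewrite -pivot_mon_nil.
by apply: mon_std_span; first exact: standard_nil.
Qed.

End StandardSpan.

(** * Generation of the standard monomials *)

Section Generation.
Variables (K : fieldType) (A : pivotAlgebra K).
Hypothesis two_neq0 : 2%:R != 0 :> K.
Local Notation x := (@gen K A).
Local Notation v := (@pivot K A).
Local Notation xs l := (\prod_(i <- l) x i).
Local Notation mon := (pivot_mon A).

Definition word_span (p : bool) : {pred A} :=
  linspan (@word_val K A) (fun w => lpar w == p).

HB.instance Definition _ p := GRing.SubmodClosed.on (word_span p).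

Lemma superbr_word_span p q : {in word_span p & word_span q,
  forall a b, superbr p q a b \in word_span (p (+) q)}.
Proof.
apply: superbr_linspan => w1 w2 /eqP <- /eqP <-.
by apply: (mem_linspan (@word_val K A) (i := LBr w1 w2)); rewrite /= eqxx.
Qed.

Definition generated (l : seq nat) (n : nat) : bool :=
  mon l n \in word_span (~~ odd (size l)).

Lemma generated_perm l1 l2 n :
  perm_eq l1 l2 -> generated l1 n -> generated l2 n.
Proof.
move=> e12; have [k e] := pivot_mon_perm A n e12.
by rewrite /generated -(perm_size e12) e; apply: rpredZ.
Qed.

Lemma generated_anticomm l1 n l2 m : generated l1 n -> generated l2 m ->
    all (gtn m) l1 -> all (gtn n) l2 ->
  xs (l1 ++ l2) * anticomm (v n) (v m) \in word_span (odd (size (l1 ++ l2))).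
Proof.
move=> gen1 gen2 lt1 lt2; have := superbr_word_span gen1 gen2.
by rewrite superbr_pivot_mon // rpredZsign addbN addNb negbK size_cat oddD.
Qed.

Lemma generated_anticomm_id l1 l2 n : generated l1 n -> generated l2 n ->
    all (gtn n) l1 -> all (gtn n) l2 ->
  generated ((l1 ++ l2) ++ [:: n.+1]) n.+3.
Proof.
move=> gen1 gen2 lt1 lt2; have := generated_anticomm gen1 gen2 lt1 lt2.
move: (l1 ++ l2) => l; rewrite /generated size_cat addn1 /= negbK.
rewrite pivot_mon_cat pivot_mon_cons pivot_mon_nil -pivot_sq /anticomm.
rewrite -mulr2n mulrnAr -scaler_nat.
by rewrite rpredZeq (negPf two_neq0).
Qed.

Lemma generated_anticommS l1 l2 n : generated l1 n -> generated l2 n.+1 ->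
    all (gtn n.+1) l1 -> all (gtn n) l2 ->
  generated ((l1 ++ l2) ++ [:: n]) n.+3.
Proof.
move=> gen1 gen2 lt1 lt2; have := generated_anticomm gen1 gen2 lt1 lt2.
move: (l1 ++ l2) => l; rewrite /generated size_cat addn1 /= negbK.
rewrite pivot_mon_cat pivot_mon_cons pivot_mon_nil anticomm_pivotS.
by rewrite mulrN rpredN.
Qed.

Lemma generated_anticommSS l1 l2 n : generated l1 n -> generated l2 n.+2 ->
    all (gtn n.+2) l1 -> all (gtn n) l2 ->
  generated ((l1 ++ l2) ++ [:: n; n.+1; n.+2]) n.+2.+3.
Proof.
move=> gen1 gen2 lt1 lt2; have := generated_anticomm gen1 gen2 lt1 lt2.
move: (l1 ++ l2) => l; rewrite /generated size_cat addn3 /= !negbK.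
rewrite pivot_mon_cat !pivot_mon_cons.
by rewrite pivot_mon_nil anticomm_pivotSS mulrN rpredN !mulrA.
Qed.

Lemma generated_behead i l m : generated [::] i -> generated (i :: l) m ->
  (i < m)%N -> i \notin l -> generated l m.
Proof.
move=> gen_i gen_il lt_im il; have := superbr_word_span gen_i gen_il.
by rewrite pivot_mon_nil /= !negbK superbr_pivot_gen.
Qed.

Lemma generated_pivot n : generated [::] n.
Proof.
elim/ltn_ind: n => n IH; have [n3 | n3] := ltnP n 3.
  rewrite /generated pivot_mon_nil.
  by apply: (mem_linspan (@word_val K A) (i := LGen (Ordinal n3))).
have [k en] : exists k, n = k.+3 by exists (n - 3)%N; lia.
rewrite en; apply: (@generated_behead k.+1) => //; first by apply: IH; lia.
by apply: (@generated_anticomm_id [::] [::]); rewrite // IH //; lia.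
Qed.

Lemma generated_subset l l' m : generated l m -> uniq l ->
    all (gtn m) l -> uniq l' -> {subset l' <= l} ->
  generated l' m.
Proof.
move=> gen_l uniq_l lt_l uniq_l' sub_l'l.
pose r := [seq i <- l | i \notin l'].
have perm_l : perm_eq l (r ++ l').
  apply: uniq_perm => // [|i].
    rewrite cat_uniq filter_uniq // uniq_l' andbT /=.
    by apply/hasPn => i il'; rewrite mem_filter il'.
  rewrite mem_cat mem_filter.
  by have [/sub_l'l ->|] := boolP (i \in l'); rewrite ?orbT ?orbF.
have := generated_perm perm_l gen_l; move: uniq_l lt_l.
rewrite (perm_uniq perm_l) (perm_all _ perm_l).
elim: r {perm_l} => [//|i r IH] /= /andP[ir uniq_r] /andP[lt_im lt_r] gen_ir.
apply: IH => //; apply: generated_behead lt_im ir => //.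
exact: generated_pivot.
Qed.

Lemma generated_max4 : generated [:: 1]%N 4.
Proof.
exact: (generated_anticommS (generated_pivot 1) (generated_pivot 2)).
Qed.

Lemma generated_max5 : generated [:: 0; 1; 2]%N 5.
Proof.
exact: (generated_anticommSS (generated_pivot 0) (generated_pivot 2)).
Qed.

Lemma generated_max7_without0 : generated [:: 1; 2; 3; 4]%N 7.
Proof. exact: (generated_anticommSS (generated_pivot 2) generated_max4). Qed.

Lemma generated_max7_without3 : generated [:: 0; 1; 2; 4]%N 7.
Proof. exact: (generated_anticommS (generated_pivot 4) generated_max5). Qed.

Lemma generated_pivot_sq n : generated [:: n.+1] n.+3.
Proof.
have gen_n := generated_pivot n.
exact: (generated_anticomm_id gen_n gen_n).
Qed.

Lemma generated_max m : (2 < m)%N -> m != 4%N -> m != 7%N ->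
  generated (iota 0 (m - 2)) m.
Proof.
elim/ltn_ind: m => m IH m3 m4 m7.
have [-> | n3] := eqVneq m 3%N.
  exact: (generated_anticommS (generated_pivot 0) (generated_pivot 1)).
have [-> | n5] := eqVneq m 5%N; first exact: generated_max5.
have [-> | n10] := eqVneq m 10%N.
  have := generated_anticommSS (generated_pivot_sq 2) generated_max7_without3.
  by move=> /(_ isT isT); apply: generated_perm.
have [k em] : exists k, m = k.+1.+2.+3 by exists (m - 6)%N; lia.
have gen_k : generated (iota 0 k.+1) k.+3.
  by have := IH k.+3; rewrite subn2; apply; lia.
have := generated_anticommSS (generated_pivot k.+1) gen_k isT.
rewrite em (_ : k.+1.+2.+3 - 2 = k.+1 + 3)%N ?iotaD; last lia.
by apply; apply/allP => s; rewrite mem_iota /=; lia.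
Qed.

Lemma first_type_generated l n : uniq l -> first_type l n -> generated l n.
Proof.
move=> uniq_l /and3P[/allP le n4 n7].
have [n2 | n3] := leqP n 2.
  case: l uniq_l le {n4 n7} => [|s l] _ le; first exact: generated_pivot.
  by have := le s (mem_head _ _); lia.
have [en | en4] := eqVneq n 4%N.
  subst n; apply: (generated_subset generated_max4) => // s sl.
  by rewrite inE; have := le s sl; have := memPn (n4 : 0%N \notin l) s sl; lia.
have [en | en7] := eqVneq n 7%N.
  subst n; have [l0 | l0] := boolP (0%N \in l).
    have l3 : 3%N \notin l by move: n7; rewrite l0.
    apply: (generated_subset generated_max7_without3) => // s sl.
    by rewrite !inE; have := le s sl; have := memPn l3 s sl; lia.
  apply: (generated_subset generated_max7_without0) => // s sl.
  by rewrite !inE; have := le s sl; have := memPn l0 s sl; lia.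
apply: (generated_subset (generated_max n3 en4 en7)); rewrite ?iota_uniq //.
  by apply/allP => s; rewrite mem_iota /=; lia.
by move=> s /le; rewrite mem_iota; lia.
Qed.

Lemma generated_covered l1 l2 l n : generated l1 n -> generated l2 n ->
    all (gtn n) l1 -> all (gtn n) l2 ->
    uniq (l1 ++ l2) -> uniq l ->
    {in l, forall s, s != n.+1 -> s \in l1 ++ l2} ->
  generated l n.+3.
Proof.
move=> gen1 gen2 lt1 lt2 uniq12 uniq_l cover.
have lt12 : all (gtn n) (l1 ++ l2) by rewrite all_cat lt1.
apply: (generated_subset (generated_anticomm_id gen1 gen2 lt1 lt2)) => //.
- rewrite cats1 rcons_uniq uniq12 andbT; apply/negP => /(allP lt12).
  by rewrite /= ltnNge leqnSn.
- by rewrite all_cat /= andbT (sub_all _ lt12) => [|s /=]; lia.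
- move=> s sl; rewrite mem_cat mem_seq1 orbC.
  by have [//|/cover->] := eqVneq s n.+1.
Qed.

Lemma second_type_generated7 l : uniq l -> second_type l 7 -> generated l 7.
Proof.
move=> uniq_l /and5P[_ _ /allP le l0 _].
apply: (generated_covered generated_max4 (generated_pivot_sq 1)) => // s sl s5.
by rewrite !inE; have := le s sl; have := memPn (l0 : 0%N \notin l) s sl; lia.
Qed.

Lemma second_type_generated10 l : uniq l -> second_type l 10 -> generated l 10.
Proof.
move=> uniq_l /and5P[_ _ /allP le _ l035].
have gen5 := generated_pivot_sq 4.
have [l0 | l0] := boolP (0%N \in l); last first.
  apply: (generated_covered generated_max7_without0 gen5) => // s sl s8.
  by rewrite !inE; have := le s sl; have := memPn l0 s sl; lia.
have [l3 | l3] := boolP (3%N \in l); last first.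
  apply: (generated_covered generated_max7_without3 gen5) => // s sl s8.
  by rewrite !inE; have := le s sl; have := memPn l3 s sl; lia.
have l5 : 5%N \notin l by move: l035; rewrite l0 l3.
have gen3 : generated [:: 3]%N 7 by apply: first_type_generated.
apply: (generated_covered gen3 generated_max7_without3) => // s sl s8.
by rewrite !inE; have := le s sl; have := memPn l5 s sl; lia.
Qed.

Lemma second_type_generated l n : uniq l -> second_type l n -> generated l n.
Proof.
move=> uniq_l type2_l; have [en | n7] := eqVneq n 7%N.
  by rewrite en in type2_l *; apply: second_type_generated7.
have [en | n10] := eqVneq n 10%N.
  by rewrite en in type2_l *; apply: second_type_generated10.
case/and5P: type2_l => n3 _ /allP le _ _; have [n5 | n6] := leqP n 5.
  have [k en] : exists k, n = k.+3 by exists (n - 3)%N; lia.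
  have gen_k := generated_pivot k.
  subst n; apply: (generated_covered gen_k gen_k) => //.
  by move=> s /le; lia.
have [k en] : exists k, n = k.+3.+3 by exists (n - 6)%N; lia.
subst n; have gen_k : generated (iota 0 k.+1) k.+3.
  by have := @generated_max k.+3; rewrite subn2; apply; lia.
apply: (generated_covered gen_k (generated_pivot_sq k)) => //.
- by apply/allP => s; rewrite mem_iota /=; lia.
- by rewrite /= ltnS leqnSn.
- by rewrite cats1 rcons_uniq iota_uniq mem_iota ltnn.
- by move=> s /le; rewrite mem_cat mem_iota mem_seq1; lia.
Qed.

Lemma std_val_word_span j :
  std_valid j -> std_val A j \in word_span (std_par j).
Proof.
move=> val; have uniq_j := std_list_uniq val.
case/orP: (std_list_standard val); first exact: first_type_generated.
exact: second_type_generated.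
Qed.

End Generation.

(** * The pivot algebra of the Grassmann algebra *)

Section PivotSeries.
Variables (R : pzRingType) (V : lmodType R) (x d v : nat -> {linear V -> V}).
Hypothesis vE : forall i p, v i p = d i p + x i (x i.+1 (v i.+3 p)).
Hypothesis v_eventually0 :
  forall p, exists N, forall m, (N <= m)%N -> v m p = 0.

(* The anticommutator of [y] with [v_m] is [x_m x_(m+1)] times the one with
   [v_(m+3)], hence vanishes on each vector for [m] large. *)
Lemma pivot_series_anticomm (y : {linear V -> V}) n :
    (forall j p, (n <= j)%N -> y (x j p) = - x j (y p)) ->
    (forall j p, (n <= j)%N -> y (d j p) = - d j (y p)) ->
  forall p, v n (y p) = - y (v n p).
Proof.
move=> yx yd p; pose c m := v m (y p) + y (v m p).
have cS m : (n <= m)%N -> c m = x m (x m.+1 (c m.+3)).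
  move=> le_nm; rewrite /c (vE m (y p)) (vE m p) linearD yd // yx // yx.
    by rewrite linearN opprK addrACA subrr add0r !linearD.
  by lia.
have [N1 v1] := v_eventually0 p; have [N2 v2] := v_eventually0 (y p).
have c0 k m : (N1 + N2 <= m + 3 * k)%N -> (n <= m)%N -> c m = 0.
  elim: k m => [|k IH] m le_N le_nm; last by rewrite cS // IH ?linear0 //; lia.
  by rewrite /c v1 ?v2 ?linear0 ?addr0 //; lia.
by apply/eqP; rewrite -addr_eq0 -/(c n) (c0 (N1 + N2)%N) //; lia.
Qed.

End PivotSeries.

Section Grassmann.
Variable K : fieldType.
Implicit Types (p : Lam K) (S : {fset nat}).

Lemma lin_ext_subset f p (D : {fset {fset nat}}) :
  msupp p `<=` D -> lin_ext K f p = \sum_(S <- D) p@_S *: f S.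
Proof.
move=> sub; rewrite /lin_ext; apply: big_fset_incl => // S _ nS.
by rewrite (mcoeff_outdom nS) scale0r.
Qed.

Fact lin_ext_is_linear f : linear (lin_ext K f).
Proof.
move=> a p q; pose D := msupp (a *: p + q) `|` (msupp p `|` msupp q).
rewrite !(@lin_ext_subset _ _ D); first last.
- by rewrite /D fsubsetUl.
- by rewrite /D fsetUA [_ `|` msupp p]fsetUC -fsetUA fsubsetUl.
- by rewrite /D fsetUA fsubsetUr.
rewrite scaler_sumr -big_split; apply: eq_bigr => S _.
by rewrite mcoeffD mcoeffZ scalerDl scalerA.
Qed.

HB.instance Definition _ f := GRing.isLinear.Build K (Lam K) (Lam K) *:%R
  (lin_ext K f) (lin_ext_is_linear f).
HB.instance Definition _ i := GRing.Linear.copy (xop K i) (lin_ext K _).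
HB.instance Definition _ i := GRing.Linear.copy (dop K i) (lin_ext K _).
HB.instance Definition _ i := GRing.Linear.copy (vop K i) (lin_ext K _).

Lemma lin_ext_xmon f S : lin_ext K f (xmon K S) = f S.
Proof.
by rewrite /lin_ext msuppU oner_eq0 big_seq_fset1 mcoeffUU scale1r.
Qed.

Lemma xmon_sum p : p = \sum_(S <- msupp p) p@_S *: xmon K S.
Proof.
rewrite {1}[p]monalgE; apply: eq_bigr => S _.
by apply/malgP => T; rewrite mcoeffZ !mcoeffU mulr_natr.
Qed.

Lemma eq_linear_xmon (f g : {linear Lam K -> Lam K}) :
  (forall S, f (xmon K S) = g (xmon K S)) -> f =1 g.
Proof.
move=> e p; rewrite [p]xmon_sum !linear_sum.
by apply: eq_bigr => S _; rewrite !linearZ /= e.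
Qed.

Lemma xop_xmon_in i S : i \in S -> xop K i (xmon K S) = 0.
Proof. by move=> iS; rewrite /xop lin_ext_xmon iS. Qed.

Lemma xop_xmon_notin i S : i \notin S ->
  xop K i (xmon K S) = (-1) ^+ nbelow i S *: xmon K (i |` S).
Proof. by move=> iS; rewrite /xop lin_ext_xmon ifN. Qed.

Lemma dop_xmon_in i S : i \in S ->
  dop K i (xmon K S) = (-1) ^+ nbelow i S *: xmon K (S `\ i).
Proof. by move=> iS; rewrite /dop lin_ext_xmon iS. Qed.

Lemma dop_xmon_notin i S : i \notin S -> dop K i (xmon K S) = 0.
Proof. by move=> iS; rewrite /dop lin_ext_xmon ifN. Qed.

(* Unification would otherwise compare operators by unfolding them. *)
Local Opaque xop dop.

Lemma nbelowD1 i j S :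
  j \in S -> nbelow i S = ((j < i) + nbelow i (S `\ j))%N.
Proof.
move=> jS; have /perm_to_rem e := jS.
rewrite /nbelow (seq.permP e) /=; congr (_ + _)%N; apply/seq.permP.
apply: uniq_perm; rewrite ?rem_uniq ?fset_uniq // => k.
by rewrite mem_rem_uniq ?fset_uniq // !inE.
Qed.

Lemma nbelowU1 i j S :
  j \notin S -> nbelow i (j |` S) = ((j < i) + nbelow i S)%N.
Proof. by move=> jS; rewrite (@nbelowD1 i j) ?fset1U1 // fsetU1K. Qed.

Lemma sign_ltn_neq (i j : nat) : i != j ->
  (-1) ^+ (i < j)%N = - (-1) ^+ (j < i)%N :> K.
Proof. by case: ltngtP => // _ _; rewrite ?opprK. Qed.

Lemma xop_sq i p : xop K i (xop K i p) = 0.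
Proof.
apply: (@eq_linear_xmon (xop K i \o xop K i) \0) => S /=.
have [iS | iS] := boolP (i \in S); first by rewrite xop_xmon_in ?linear0.
by rewrite xop_xmon_notin // linearZ /= xop_xmon_in ?fset1U1 ?scaler0.
Qed.

Lemma dop_sq i p : dop K i (dop K i p) = 0.
Proof.
apply: (@eq_linear_xmon (dop K i \o dop K i) \0) => S /=.
have [iS | iS] := boolP (i \in S); last by rewrite dop_xmon_notin ?linear0.
by rewrite dop_xmon_in // linearZ /= dop_xmon_notin ?scaler0 // !inE eqxx.
Qed.

Lemma xopC i j p : xop K i (xop K j p) = - xop K j (xop K i p).
Proof.
have [-> | ne_ij] := eqVneq i j; first by rewrite xop_sq oppr0.
apply: (@eq_linear_xmon (xop K i \o xop K j) (\- (xop K j \o xop K i))) => S /=.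
have xx_in k l : k \in S -> xop K k (xop K l (xmon K S)) = 0.
  move=> kS; have [lS | lS] := boolP (l \in S).
    by rewrite (xop_xmon_in lS) linear0.
  by rewrite xop_xmon_notin // linearZ /= xop_xmon_in ?scaler0 // fset1Ur.
have [iS | iS] := boolP (i \in S).
  by rewrite (xx_in i) // (xop_xmon_in iS) linear0 oppr0.
have [jS | jS] := boolP (j \in S).
  by rewrite (xx_in j) // (xop_xmon_in jS) linear0 oppr0.
rewrite !xop_xmon_notin // !linearZ /= !xop_xmon_notin; first last.
- by rewrite in_fset1U negb_or ne_ij.
- by rewrite in_fset1U negb_or eq_sym ne_ij.
rewrite scalerN !scalerA -scaleNr fsetUCA; congr (_ *: _).
rewrite !nbelowU1 // !exprD (sign_ltn_neq ne_ij) mulNr mulrN opprK.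
by rewrite mulrCA [RHS]mulrCA [_ * (-1) ^+ nbelow i S]mulrC.
Qed.

Lemma dopC i j p : dop K i (dop K j p) = - dop K j (dop K i p).
Proof.
have [-> | ne_ij] := eqVneq i j; first by rewrite dop_sq oppr0.
apply: (@eq_linear_xmon (dop K i \o dop K j) (\- (dop K j \o dop K i))) => S /=.
have dd_notin k l : k \notin S -> dop K k (dop K l (xmon K S)) = 0.
  move=> kS; have [lS | lS] := boolP (l \in S); last first.
    by rewrite (dop_xmon_notin lS) linear0.
  rewrite dop_xmon_in // linearZ /= dop_xmon_notin ?scaler0 //.
  by rewrite in_fsetD1 negb_and kS orbT.
have [iS | iS] := boolP (i \in S); last first.
  by rewrite (dd_notin i) // (dop_xmon_notin iS) linear0 oppr0.
have [jS | jS] := boolP (j \in S); last first.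
  by rewrite (dd_notin j) // (dop_xmon_notin jS) linear0 oppr0.
rewrite !dop_xmon_in // !linearZ /= !dop_xmon_in; first last.
- by rewrite in_fsetD1 ne_ij.
- by rewrite in_fsetD1 eq_sym ne_ij.
rewrite scalerN !scalerA -scaleNr !fsetDDl [[fset j; i]]fsetUC; congr (_ *: _).
rewrite (nbelowD1 j iS) (nbelowD1 i jS) !exprD.
by rewrite (sign_ltn_neq ne_ij) !mulNr mulrAC.
Qed.

Lemma dop_xop_id i p : dop K i (xop K i p) + xop K i (dop K i p) = p.
Proof.
apply: (@eq_linear_xmon ((dop K i \o xop K i) \+ (xop K i \o dop K i)) idfun).
move=> S /=; have [iS | iS] := boolP (i \in S).
  rewrite xop_xmon_in // linear0 add0r dop_xmon_in // linearZ /=.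
  rewrite xop_xmon_notin ?in_fsetD1 ?eqxx // fsetD1K // scalerA (nbelowD1 i iS).
  by rewrite ltnn -signr_odd -signr_addb addbb scale1r.
rewrite dop_xmon_notin // linear0 addr0 xop_xmon_notin // linearZ /=.
rewrite dop_xmon_in ?fset1U1 // fsetU1K // scalerA nbelowU1 // ltnn.
by rewrite -signr_odd -signr_addb addbb scale1r.
Qed.

Lemma dop_xop_neq i j p : i != j ->
  dop K i (xop K j p) + xop K j (dop K i p) = 0.
Proof.
move=> ne_ij.
apply: (@eq_linear_xmon ((dop K i \o xop K j) \+ (xop K j \o dop K i)) \0).
move=> S /=; have [iS | iS] := boolP (i \in S);
  have [jS | jS] := boolP (j \in S).
- rewrite xop_xmon_in // linear0 add0r dop_xmon_in // linearZ /=.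
  by rewrite xop_xmon_in ?scaler0 // in_fsetD1 eq_sym ne_ij.
- rewrite xop_xmon_notin // dop_xmon_in // !linearZ /=.
  rewrite dop_xmon_in ?in_fset1U ?iS ?orbT //.
  rewrite xop_xmon_notin ?in_fsetD1 ?negb_and ?jS ?orbT // !scalerA.
  have -> : (j |` S) `\ i = j |` (S `\ i).
    apply/fsetP=> k; rewrite !inE; case: eqVneq => // ->.
    by rewrite (negPf ne_ij).
  rewrite nbelowU1 // (nbelowD1 j iS) !exprD (sign_ltn_neq ne_ij) -scalerDl.
  by rewrite !mulNr mulrACA -signr_addb addbb mul1r mulrC addNr scale0r.
- by rewrite xop_xmon_in // dop_xmon_notin // !linear0 addr0.
- rewrite [dop K i (xmon K S)]dop_xmon_notin // linear0 addr0 xop_xmon_notin //.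
  rewrite linearZ /= dop_xmon_notin ?scaler0 //.
  by rewrite in_fset1U negb_or ne_ij.
Qed.

Lemma prodx0 l : prodx K l 0 = 0.
Proof. by elim: l => //= j l ->; rewrite linear0. Qed.

Lemma prodx_cat l1 l2 p : prodx K (l1 ++ l2) p = prodx K l1 (prodx K l2 p).
Proof. by elim: l1 => [//|j l1 IH]; apply: congr1 IH. Qed.

Lemma dop_xmon_gt i S :
  (\max_(s <- enum_fset S) s < i)%N -> dop K i (xmon K S) = 0.
Proof.
move=> lt; apply: dop_xmon_notin; apply: contraL lt => iS.
by rewrite -leqNgt; apply: leq_bigmax_seq.
Qed.

Lemma vop_xmon i S N : (\max_(s <- enum_fset S) s < N)%N ->
  vop K i (xmon K S) =
  \sum_(k < N) prodx K (pivot_list i k) (dop K (i + 3 * k) (xmon K S)).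
Proof.
move=> lt; rewrite /vop lin_ext_xmon.
pose F k := prodx K (pivot_list i k) (dop K (i + 3 * k) (xmon K S)).
rewrite -![RHS](big_mkord xpredT F) (big_cat_nat (leq0n _) lt) /=.
rewrite [X in _ = _ + X]big1_seq ?addr0 ?big_mkord // => k /=.
rewrite mem_index_iota => /andP[lt_k _].
by rewrite /F dop_xmon_gt ?prodx0 //; apply: leq_trans lt_k _; lia.
Qed.

Local Opaque vop.

Lemma vopE i p :
  vop K i p = dop K i p + xop K i (xop K i.+1 (vop K i.+3 p)).
Proof.
apply: (@eq_linear_xmon (vop K i)
  (dop K i \+ (xop K i \o (xop K i.+1 \o vop K i.+3)))) => S /=.
set M := (\max_(s <- enum_fset S) s)%N.
rewrite (@vop_xmon i S M.+2) // (@vop_xmon i.+3 S M.+1) // big_ord_recl.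
rewrite muln0 addn0; congr (_ + _).
rewrite [xop K i.+1 _]linear_sum [RHS]linear_sum; apply: eq_bigr => k _.
rewrite lift0 pivot_listS (_ : i + 3 * k.+1 = i.+3 + 3 * k)%N; last lia.
by [].
Qed.

Lemma vop_eventually0 p : exists N, forall m, (N <= m)%N -> vop K m p = 0.
Proof.
exists (\max_(S <- msupp p) (\max_(s <- enum_fset S) s).+1)%N => m le_m.
rewrite [p]xmon_sum linear_sum big_seq big1 // => S S_p.
rewrite linearZ /= (@vop_xmon m S _ (leqnn _)) big1 ?scaler0 // => k _.
rewrite dop_xmon_gt ?prodx0 //; apply: leq_trans (_ : m <= _)%N; last lia.
by apply: leq_trans le_m; apply: (leq_bigmax_seq S S_p isT).
Qed.

Let vop_anticomm := pivot_series_anticomm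
  (x := fun i => xop K i : {linear Lam K -> Lam K})
  (d := fun i => dop K i : {linear Lam K -> Lam K})
  (v := fun i => vop K i : {linear Lam K -> Lam K}) vopE vop_eventually0.

Lemma vop_xop n j p :
  (j < n)%N -> vop K n (xop K j p) = - xop K j (vop K n p).
Proof.
move=> lt_jn; apply: (vop_anticomm (y := xop K j)) => i {}p le_ni.
  exact: xopC.
have := @dop_xop_neq i j p; rewrite addrC gtn_eqF; last lia.
by move=> /(_ isT)/eqP; rewrite addr_eq0 => /eqP.
Qed.

Lemma vop_dop n j p :
  (j < n)%N -> vop K n (dop K j p) = - dop K j (vop K n p).
Proof.
move=> lt_jn; apply: (vop_anticomm (y := dop K j)) => i {}p le_ni.
  have := @dop_xop_neq j i p; rewrite ltn_eqF; last lia.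
  by move=> /(_ isT)/eqP; rewrite addr_eq0 => /eqP.
exact: dopC.
Qed.

Lemma Lam_neq0 : exists u : Lam K, u != 0.
Proof. by exists (xmon K fset0); rewrite monalgU_eq0 oner_eq0. Qed.

Local Notation E := (linEnd Lam_neq0).
Definition xend i : E := xop K i.
Definition dend i : E := dop K i.
Definition vend i : E := vop K i.

Fact xend_sq i : xend i * xend i = 0.
Proof. by apply: linEndP => p; apply: xop_sq. Qed.
Fact dend_sq i : dend i * dend i = 0.
Proof. by apply: linEndP => p; apply: dop_sq. Qed.
Fact anticomm_xend i j : anticomm (xend i) (xend j) = 0.
Proof.
by apply: linEndP => p; apply/eqP; rewrite addr_eq0; apply/eqP/xopC.
Qed.
Fact anticomm_dend_xend i j : anticomm (dend i) (xend j) = (i == j)%:R.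
Proof.
apply: linEndP => p; have [<- | ne_ij] := eqVneq i j.
  exact: dop_xop_id.
exact: dop_xop_neq.
Qed.
Fact vendE i : vend i = dend i + xend i * xend i.+1 * vend i.+3.
Proof. by apply: linEndP => p; apply: vopE. Qed.
Fact anticomm_vend_xend i j : (j < i)%N -> anticomm (vend i) (xend j) = 0.
Proof.
move=> lt_ji; apply: linEndP => p; apply/eqP; rewrite addr_eq0.
exact/eqP/vop_xop.
Qed.
Fact anticomm_vend_dend i j : (j < i)%N -> anticomm (vend i) (dend j) = 0.
Proof.
move=> lt_ji; apply: linEndP => p; apply/eqP; rewrite addr_eq0.
exact/eqP/vop_dop.
Qed.

Definition grassmann : pivotAlgebra K :=
  PivotAlgebra xend_sq dend_sq anticomm_xend anticomm_dend_xend vendE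
    anticomm_vend_xend anticomm_vend_dend.

Lemma std_opE j p :
  std_op K j p = prodx K (std_list j) (vop K j.1.2 p).
Proof. by case: j => [[[] n] T]; rewrite prodx_cat. Qed.

Lemma std_valE j p : linEnd_fun (std_val grassmann j) p = std_op K j p.
Proof.
have prodE l q : linEnd_fun (\prod_(i <- l) xend i) q = prodx K l q.
  elim: l q => [|i l IH] q; first by rewrite big_nil.
  by rewrite big_cons /= -IH.
by rewrite std_opE -prodE.
Qed.

Lemma word_valE w p : linEnd_fun (word_val grassmann w) p = leval K w p.
Proof.
elim: w p => [//|w1 IH1 w2 IH2] p /=.
by rewrite /sbr -!(IH1, IH2).
Qed.

End Grassmann.

(** * Linear independence *)

Section Independence.
Variable K : fieldType.

Lemma vop_xmon1_gt m n : (n < m)%N -> vop K m (xmon K [fset n]) = 0.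
Proof.
move=> lt_nm; rewrite (@vop_xmon K m _ _ (leqnn _)) big1 // => k _.
by rewrite dop_xmon_notin ?prodx0 // inE; lia.
Qed.

Lemma vop_xmon1 n : vop K n (xmon K [fset n]) = xmon K fset0.
Proof.
rewrite (@vop_xmon K n _ n.+1) ?big_seq_fset1 // big_ord_recl big1 => [|k _].
  rewrite muln0 addn0 addr0 /= dop_xmon_in ?fset11 // (nbelowD1 n (fset11 n)).
  by rewrite ltnn fsetDv scale1r.
by rewrite lift0 dop_xmon_notin ?prodx0 // inE; lia.
Qed.

Lemma prodx_xmon0 l : uniq l -> exists k : nat,
  prodx K l (xmon K fset0) = (-1) ^+ k *: xmon K [fset s in l].
Proof.
elim: l => [_|i l IH /andP[il /IH[k e]]].
  by exists 0%N; rewrite scale1r; congr xmon; apply/fsetP => s; rewrite !inE.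
have il' : i \notin [fset s in l] by rewrite in_fset.
exists (k + nbelow i [fset s in l])%N.
rewrite -[LHS]/(xop K i (prodx K l (xmon K fset0))) e.
rewrite linearZ /= (xop_xmon_notin K il') scalerA exprD.
by congr (_ *: xmon K _); apply/fsetP => s; rewrite !inE.
Qed.

Lemma std_op_xmon1 j : std_valid j -> exists k : nat,
  std_op K j (xmon K [fset j.1.2]) = (-1) ^+ k *: xmon K [fset s in std_list j].
Proof.
move=> /std_list_uniq/prodx_xmon0[k e].
by exists k; rewrite std_opE vop_xmon1 e.
Qed.

Lemma std_op_free (s : seq std) (c : std -> K) :
  uniq s -> all std_valid s ->
  (forall p : Lam K, \sum_(j <- s) c j *: std_op K j p = 0) ->
  forall j, j \in s -> c j = 0.
Proof.
move=> uniq_s /allP val_s rel j.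
have [n] := ubnP j.1.2; elim: n j => [//|n IH] j le_jn js.
have := congr1 (mcoeff [fset i in std_list j]) (rel (xmon K [fset j.1.2])).
rewrite mcoeff0 raddf_sum (bigD1_seq j) //=.
rewrite big1_seq ?addr0 => [|j' /andP[ne_j'j j's]]; rewrite mcoeffZ.
  have [k ->] := std_op_xmon1 (val_s j js).
  rewrite mcoeffZ mcoeffUU mulr1 => /eqP; rewrite mulf_eq0 signr_eq0 orbF.
  by move/eqP.
have [lt_j'j | gt_j'j | eq_j'j] := ltngtP j'.1.2 j.1.2.
- by rewrite IH ?mul0r //; lia.
- by rewrite std_opE vop_xmon1_gt // prodx0 mcoeff0 mulr0.
rewrite -eq_j'j; have [k ->] := std_op_xmon1 (val_s j' j's).
rewrite mcoeffZ mcoeffU; case: eqP => [eq_lists|]; last by rewrite !mulr0.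
case/eqP: ne_j'j; apply: std_list_inj; rewrite ?val_s // => i.
by have /fsetP/(_ i) := eq_lists; rewrite !in_fset.
Qed.

End Independence.

Theorem theorem5p1 (K : fieldType) (hK : ~~ (2%N \in [pchar K])) :
  [/\ (forall (s : seq std) (c : std -> K),
         uniq s -> all std_valid s ->
         (forall p : Lam K, \sum_(j <- s) c j *: std_op K j p = 0) ->
         forall j, j \in s -> c j = 0),
      (forall j : std, std_valid j ->
         exists ws : seq (K * lword),
           forall p : Lam K, std_op K j p = \sum_(w <- ws) w.1 *: leval K w.2 p)
    & (forall w : lword,
         exists js : seq (K * std),
           all (fun j => std_valid j.2) js /\
           forall p : Lam K, leval K w p = \sum_(j <- js) j.1 *: std_op K j.2 p)].
Proof.
have two_neq0 : 2%:R != 0 :> K.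
  by apply: contraNneq hK => e; rewrite inE /= e eqxx.
split; first exact: std_op_free.
- move=> j /(std_val_word_span (grassmann K) two_neq0)/linspanP[ws [_ e]].
  exists ws => p; rewrite -std_valE e linEnd_sumE.
  by apply: eq_bigr => w _; rewrite -word_valE.
- move=> w; have /linspanP[js [val e]] := word_val_std_span (grassmann K) w.
  exists js; split=> [|p]; first by apply: sub_all val => j /andP[].
  rewrite -word_valE e linEnd_sumE.
  by apply: eq_bigr => j _; rewrite -std_valE.
Qed.
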